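(* Let $K$ be a field and let $P \subset \mathbb{R}^d$ be a $(0,1)$-polytope satisfying condition (E). Then $P$ has the clique-face property if and only if every monomial appearing in a binomial in $I_P$ is divisible by a quadratic monomial appearing in a quadratic binomial in $I_P$. In particular, if $P$ has the clique-face property, then $I_P$ has no indispensable monomials of degree $\ge 3$.
   Context: A $(0,1)$-polytope in $\mathbb{R}^d$ is a convex polytope all of whose vertices lie in $\{0,1\}^d$; then $P\cap\mathbb{Z}^d$ is exactly the vertex set $\{\mathbf{a}_1,\dots,\mathbf{a}_n\}$ of $P$. Condition (E): two distinct vertices $\mathbf{a}_i$ and $\mathbf{a}_j$ of $P$ form an edge of $P$ (i.e. $\mathrm{conv}(\{\mathbf{a}_i,\mathbf{a}_j\})$ is an edge) if and only if there exists a unique way (up to order) to write $\mathbf{a}_i+\mathbf{a}_j$ as the sum of two (not necessarily distinct) vertices of $P$. The $1$-skeleton $\mathrm{sk}(P)$ is the finite simple graph on the vertices of $P$, with two distinct vertices $v,w$ adjacent iff $\mathrm{conv}(\{v,w\})$ is an edge of $P$. A clique of a graph is the vertex set of a complete subgraph. $P$ has the clique-face property if every clique of $\mathrm{sk}(P)$ is the vertex set of a face of $P$, where $P$ itself is regarded as a face of $P$. The toric ideal $I_P$ is the kernel of the $K$-algebra homomorphism $\pi : K[x_1,\dots,x_n] \to K[t_1^{\pm1},\dots,t_d^{\pm 1},s]$, $\pi(x_i)=\mathbf{t}^{\mathbf{a}_i}s$, where $\mathbf{t}^{\mathbf{a}}=t_1^{a_1}\cdots t_d^{a_d}$. A binomial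 is a difference $u-v$ of two distinct monomials (in particular it is nonzero), and $u,v$ are the monomials appearing in it. A quadratic binomial is a homogeneous binomial of degree $2$. $I_P$ is generated by homogeneous binomials. A monomial $m$ is indispensable (for $I_P$) if every system of binomial generators of $I_P$ contains a binomial in which $m$ appears. *)

(* Defs.v *)
From mathcomp Require Export all_boot all_order all_algebra.
From mathcomp Require Export classical_sets reals.
From mathcomp Require Export fraction mpoly.

Set Implicit Arguments.
Unset Strict Implicit.
Unset Printing Implicit Defensive.

Import Order.TTheory GRing.Theory Num.Theory.

Local Open Scope classical_set_scope.
Local Open Scope ring_scope.

Section Polytopes.
Variables (R : realType) (d : nat).
Implicit Types (P F C S : set 'rV[R]_d) (v w x : 'rV[R]_d).

Definition conv S : set 'rV[R]_d :=
  [set x | exists (m : nat) (p : 'I_m -> 'rV[R]_d) (l : 'I_m -> R),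
     [/\ forall i, S (p i), forall i, 0 <= l i, \sum_i l i = 1
       & x = \sum_i l i *: p i]].

Definition polytope P := exists s : seq 'rV[R]_d, P = conv [set x | x \in s].

(* c = 0 gives the faces P (b = 0) and set0 (b = 1). *)
Definition face P F := exists (c : 'rV[R]_d) (b : R),
  (forall x, P x -> \sum_k c 0 k * x 0 k <= b) /\
  F = P `&` [set x : 'rV[R]_d | \sum_k c 0 k * x 0 k = b].

Definition vertices P : set 'rV[R]_d := [set v | face P [set v]].

(* The one-dimensional faces: a polytope of dimension 1 is a nondegenerate
   segment. *)
Definition edge P F :=
  face P F /\ exists v w, v != w /\ F = conv [set v; w].

Definition polytope01 P :=
  polytope P /\ forall v, vertices P v -> forall k, v 0 k = 0 \/ v 0 k = 1.

Definition unique_vertex_sum P x := exists v w,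
  [/\ vertices P v, vertices P w, x = v + w
    & forall v' w', vertices P v' -> vertices P w' -> x = v' + w' ->
        perm_eq [:: v'; w'] [:: v; w]].

Definition conditionE P := forall v w,
  vertices P v -> vertices P w -> v != w ->
  (edge P (conv [set v; w]) <-> unique_vertex_sum P (v + w)).

Definition skeleton P v w :=
  [/\ vertices P v, vertices P w, v != w & edge P (conv [set v; w])].

Definition clique P C :=
  C `<=` vertices P /\ forall v w, C v -> C w -> v != w -> skeleton P v w.

Definition clique_face P := forall C,
  clique P C -> exists2 F, face P F & C = vertices F.

End Polytopes.

Section ToricIdeal.
Variables (K : fieldType) (d n : nat).

(* K[t_1^{+-1}, ..., t_d^{+-1}, s] is regarded as a subring of the fraction
   field K(t_1, ..., t_d, s) of {mpoly K[d + 1]}, whose last variable is s;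
   enlarging the codomain does not change the kernel of the toric map. *)
Definition laurent_t (k : 'I_d) : {fraction {mpoly K[d + 1]}} :=
  tofrac 'X_(lshift 1 k).

Definition laurent_s : {fraction {mpoly K[d + 1]}} := tofrac 'X_(rshift d ord0).

Definition toric_map (a : 'I_n -> 'rV[int]_d) :
    {mpoly K[n]} -> {fraction {mpoly K[d + 1]}} :=
  mmap (fun c : K => tofrac c%:MP)
       (fun i => (\prod_(k < d) laurent_t k ^ a i 0 k) * laurent_s).

Definition toric_ideal (a : 'I_n -> 'rV[int]_d) : set {mpoly K[n]} :=
  [set f | toric_map a f = 0].

Definition binomial (f : {mpoly K[n]}) :=
  exists u v : 'X_{1..n}, u != v /\ f = 'X_[u] - 'X_[v].

Definition quadratic_binomial (f : {mpoly K[n]}) :=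
  binomial f /\ f \is 2.-homog.

Definition ideal_generated (G : set {mpoly K[n]}) : set {mpoly K[n]} :=
  [set f | exists s : seq ({mpoly K[n]} * {mpoly K[n]}),
     (forall c, c \in s -> G c.2) /\ f = \sum_(c <- s) c.1 * c.2].

Definition binomial_generators (I G : set {mpoly K[n]}) :=
  (forall g, G g -> binomial g) /\ ideal_generated G = I.

(* Monomials are given by their exponent vectors; those appearing in f form
   msupp f. *)
Definition indispensable (I : set {mpoly K[n]}) (m : 'X_{1..n}) :=
  forall G, binomial_generators I G -> exists2 g, G g & m \in msupp g.

Definition binomial_monomials_quadratic (I : set {mpoly K[n]}) :=
  forall (f : {mpoly K[n]}) (m : 'X_{1..n}),
    I f -> binomial f -> m \in msupp f ->
    exists (g : {mpoly K[n]}) (q : 'X_{1..n}),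
      [/\ I g, quadratic_binomial g, q \in msupp g & (q <= m)%MM].

End ToricIdeal.

Arguments toric_ideal K {d n} a _.

(* Main.v *)
Require Import Defs.
From mathcomp Require Import boolp ring lra.

(** Write A i for the vertex of P with integer coordinates a i. The
    elements of I_P are governed by fibers: two monomials u, v have the
    same image under the toric map exactly when they have the same degree and
    the same point sum_i u_i a_i (their [fiber]), and I_P is spanned by the
    differences of monomials in a common fiber ([toric_idealP],
    [toric_ideal_binomial], [toric_ideal_sub_generated]). So the divisibility
    condition says: every monomial u that shares its fiber with another
    monomial is divisible by a quadratic monomial with the same property
    ([binomial_monomials_quadraticP], [quadric_reducible]). By (E), for i <> j
    the monomial x_i x_j is alone in its fiber exactly when A i and A j span an
    edge ([edge_unique_fiber]); and x_i^2 is always alone in its fiber, because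
    0/1 points have no nontrivial midpoints among themselves ([fiber_double]).

    Clique-face implies divisibility ([clique_face_reducible]): if u <> v
    share a fiber and no such quadric divides u, cancel the common factor to
    get u', v' with disjoint supports. The support of u' is a clique, hence the
    vertex set of a face. The mean of the functional defining the face,
    weighted by u', is its maximum on P; weighted by v' it is the same, because
    u' and v' share a fiber; so the support of v' lies in the face too
    ([face_fiber_support]), hence in the support of u'. So v' = 1, and u' = 1
    by degree.

    Divisibility implies clique-face ([reducible_clique_face]): for a clique C
    and a vertex A j outside C, the Farkas lemma over the integers ([farkas])
    gives either a functional that is maximal on C and strictly smaller at A j,
    or monomials u, v in one fiber with u supported on C and x_j dividing v
    ([separate_or_fiber]). The second case is impossible, since a quadric
    dividing u would be alone in its fiber. The sum of the functionals over all
    j then defines a face, whose vertices are exactly the points of C. This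
    uses that a linear functional on a polytope is bounded by its values at the
    vertices ([le_of_vertices]) and that the vertices of a face are the
    vertices of P lying in it ([vertices_of_face]).

    Indispensability ([not_indispensable_reducible]): if x^m, of degree at
    least 3, is divisible by x^q with x^q - x^q' in I_P, then x^m - x^v is a
    multiple of x^q - x^q' plus x^(m-q+q') - x^v, and x^m appears in neither
    binomial. Hence the binomials of I_P in which x^m does not appear already
    generate I_P. *)

Set Implicit Arguments.
Unset Strict Implicit.
Unset Printing Implicit Defensive.

Import Order.TTheory GRing.Theory Num.Theory.

Local Open Scope classical_set_scope.
Local Open Scope ring_scope.

(** * The Farkas lemma over an ordered ring *)

Section Dot.
Variables (R : comPzRingType) (m : nat).
Implicit Types (c x y : 'rV[R]_m).

Definition dot c x := \sum_k c 0 k * x 0 k.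

Lemma dotC c x : dot c x = dot x c.
Proof. by apply: eq_bigr => k _; rewrite mulrC. Qed.

Lemma dotDr c x y : dot c (x + y) = dot c x + dot c y.
Proof. by rewrite -big_split; apply: eq_bigr => k _; rewrite mxE mulrDr. Qed.

Lemma dotZr c t x : dot c (t *: x) = t * dot c x.
Proof. by rewrite mulr_sumr; apply: eq_bigr => k _; rewrite mxE mulrCA. Qed.

Lemma dotNr c x : dot c (- x) = - dot c x.
Proof. by rewrite -scaleN1r dotZr mulN1r. Qed.

Lemma dot0r c : dot c 0 = 0.
Proof. by rewrite -(scale0r 0) dotZr mul0r. Qed.

Lemma dot_sumr (I : Type) (r : seq I) (Q : pred I) (F : I -> 'rV[R]_m) c :
  dot c (\sum_(i <- r | Q i) F i) = \sum_(i <- r | Q i) dot c (F i).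
Proof. exact: (big_morph _ (dotDr c) (dot0r c)). Qed.

Lemma dotDl c x y : dot (x + y) c = dot x c + dot y c.
Proof. by rewrite dotC dotDr !(dotC c). Qed.

Lemma dotZl c t x : dot (t *: x) c = t * dot x c.
Proof. by rewrite dotC dotZr dotC. Qed.

Lemma dotNl c x : dot (- x) c = - dot x c.
Proof. by rewrite dotC dotNr dotC. Qed.

End Dot.

Lemma dot_ge0 (R : realDomainType) m (x : 'rV[R]_m) : 0 <= dot x x.
Proof. by apply: sumr_ge0 => k _; rewrite -expr2 sqr_ge0. Qed.

Lemma dot_eq0 (R : realDomainType) m (x : 'rV[R]_m) : (dot x x == 0) = (x == 0).
Proof.
apply/idP/eqP => [|->]; last by rewrite dot0r.
rewrite psumr_eq0 => [/allP x0|k _]; last by rewrite -expr2 sqr_ge0.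
apply/rowP => k; rewrite mxE; apply/eqP.
by have := x0 k (mem_index_enum _); rewrite /= mulf_eq0 orbb.
Qed.

(** Stated without division so that it yields integer coefficients when R is
    the ring of integers. Induction on the number N of generators: if a
    solution y for the generators other than v0 violates v0, project everything
    along v0 so that the projections vanish at y; both alternatives lift back. *)
Lemma farkas (R : realDomainType) m N (v : 'I_N -> 'rV[R]_m) (g : 'rV[R]_m) :
  (exists2 x, (forall i, dot (v i) x <= 0) & 0 < dot g x) \/
  (exists (t : R) (l : 'I_N -> R),
     [/\ 0 < t, forall i, 0 <= l i & t *: g = \sum_i l i *: v i]).
Proof.
elim: N v g => [|N IH] v g.
  have [->|g0] := eqVneq g 0.
    by right; exists 1, (fun _ => 0); split=> //; rewrite scaler0 big_ord0.
  left; exists g; first by case.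
  by rewrite lt_neqAle eq_sym dot_eq0 g0 dot_ge0.
pose w i := v (lift ord0 i); pose v0 := v ord0.
have [[y wy gy]|[t [l [t0 l0 tg]]]] := IH w g; last first.
  right; exists t, (fun i => if unlift ord0 i is Some j then l j else 0).
  split => // [i|]; first by case: unliftP => [j _|_].
  rewrite big_ord_recl unlift_none scale0r add0r tg.
  by apply: eq_bigr => i _; rewrite liftK.
have [v0y|v0y] := lerP (dot v0 y) 0.
  by left; exists y => // i; case: (unliftP ord0 i) => [j|] ->; [exact: wy|].
(* proj z is dot v0 y times the projection of z along v0 to the orthogonal of
   y. *)
pose proj z := dot v0 y *: z - dot z y *: v0.
have [[x wx gx]|[t [l [t0 l0 tg]]]] := IH (proj \o w) (proj g).
  have projE z : dot (proj z) x = dot z (dot v0 y *: x - dot v0 x *: y).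
    rewrite dotDl dotZl dotNl dotZl dotDr dotZr dotNr dotZr; ring.
  left; exists (dot v0 y *: x - dot v0 x *: y); last by rewrite -projE.
  move=> i; case: (unliftP ord0 i) => [j|] ->.
    by rewrite -projE; exact: wx.
  by rewrite dotDr dotZr dotNr dotZr -/v0 mulrC subrr.
right; exists (t * dot v0 y).
exists (fun i => if unlift ord0 i is Some j then dot v0 y * l j
  else t * dot g y - \sum_j l j * dot (w j) y).
split=> [|i|]; first exact: mulr_gt0.
  case: unliftP => [j _|_]; first by rewrite mulr_ge0 // ltW.
  rewrite subr_ge0 (@le_trans _ _ 0) //; last by rewrite ltW // mulr_gt0.
  by apply: sumr_le0 => j _; rewrite mulr_ge0_le0.
rewrite big_ord_recl unlift_none.
rewrite [X in _ + X](eq_bigr (fun i => (dot v0 y * l i) *: w i)); last first.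
  by move=> i _; rewrite liftK.
move: tg; rewrite /proj scalerBr => /eqP; rewrite subr_eq => /eqP.
rewrite !scalerA => ->.
rewrite [X in X + _](eq_bigr (fun i =>
  (dot v0 y * l i) *: w i - (l i * dot (w i) y) *: v0)); last first.
  by move=> i _; rewrite /= scalerBr !scalerA [l i * dot v0 y]mulrC.
by rewrite sumrB -scaler_suml scalerBl addrAC -addrA [RHS]addrC.
Qed.

(** * Vertices and faces of a polytope *)

Lemma max_in_seq (R : realDomainType) (T : eqType) (f : T -> R) (s : seq T) :
  s != [::] -> exists2 y, y \in s & forall x, x \in s -> f x <= f y.
Proof.
elim: s => [//|z s IH] _; have [->|/IH [y ys fy]] := eqVneq s [::].
  by exists z; rewrite ?mem_head // => x; rewrite inE => /eqP ->.
have [zy|yz] := lerP (f z) (f y).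
  exists y; first by rewrite inE ys orbT.
  by move=> x; rewrite inE => /predU1P [->|/fy].
exists z; rewrite ?mem_head // => x; rewrite inE => /predU1P [->//|/fy xy].
exact: le_trans xy (ltW yz).
Qed.

(** Lets M * c + c' imitate the lexicographic order on (c, c') on finitely many
    points. The quantification over M' allows taking the larger of two bounds
    in the induction. *)
Lemma dominating_multiple (R : realFieldType) (T : eqType) (f g : T -> R)
    (s : seq T) :
  exists M, forall M' x, M <= M' -> x \in s -> 0 < f x -> g x < M' * f x.
Proof.
elim: s => [|z s [M HM]]; first by exists 0.
exists (Num.max M (if 0 < f z then (g z + 1) / f z else 0)) => M' x.
rewrite ge_max inE => /andP [MM' zM'] /predU1P [->|xs] fx; last exact: HM.
move: zM'; rewrite fx ler_pdivrMr //; apply: lt_le_trans.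
by rewrite ltrDl.
Qed.

Section Polytopes.
Variables (R : realType) (d : nat).
Implicit Types (P F C : set 'rV[R]_d) (s : seq 'rV[R]_d) (c x y : 'rV[R]_d).

Lemma mem_conv s x : x \in s -> conv [set y | y \in s] x.
Proof.
move=> xs; exists 1%N, (fun _ => x), (fun _ => 1).
by split=> //=; rewrite big_ord1 ?scale1r.
Qed.

Lemma conv_le s c (b : R) : (forall x, x \in s -> dot c x <= b) ->
  forall x, conv [set y | y \in s] x -> dot c x <= b.
Proof.
move=> sb _ [m [p [l [ps l0 l1 ->]]]].
rewrite dot_sumr -[b]mul1r -l1 mulr_suml; apply: ler_sum => i _.
by rewrite dotZr ler_wpM2l // sb //; exact: ps.
Qed.

Lemma conv_strict_max s c (b : R) y :
    (forall x, x \in s -> dot c x <= b) ->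
    (forall x, x \in s -> dot c x = b -> x = y) ->
  forall x, conv [set y | y \in s] x -> dot c x = b -> x = y.
Proof.
move=> sb sy _ [m [p [l [ps l0 l1 ->]]]].
rewrite dot_sumr -[b]mul1r -l1 mulr_suml => /esym /eqP.
rewrite -subr_eq0 -sumrB psumr_eq0 => [/allP lp|i _]; last first.
  by rewrite dotZr -mulrBr mulr_ge0 // subr_ge0 sb //; exact: ps.
rewrite -[y]scale1r -l1 scaler_suml; apply: eq_bigr => i _.
have := lp i (mem_index_enum _); rewrite /= dotZr -mulrBr mulf_eq0.
case/orP => [/eqP ->|]; first by rewrite !scale0r.
by rewrite subr_eq0 => /eqP e; rewrite (sy (p i)) //; exact: ps.
Qed.

(** With M large, M * c + c' is maximal at y alone: on the finite set s, c
    decides unless it takes the value it has at y, and then c' decides. *)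
Lemma lexicographic_vertex s c c' y : conv [set x | x \in s] y ->
    (forall x, x \in s -> dot c x <= dot c y) ->
    (forall x, x \in s -> dot c x = dot c y ->
       dot c' x <= dot c' y /\ (dot c' x = dot c' y -> x = y)) ->
  vertices (conv [set x | x \in s]) y.
Proof.
move=> Py cy c'y.
have [M HM] := dominating_multiple (fun x => dot c y - dot c x)
  (fun x => dot c' x - dot c' y) s.
pose e := M *: c + c'.
have eE x : dot e x - dot e y =
    (dot c' x - dot c' y) - M * (dot c y - dot c x).
  by rewrite !dotDl !dotZl; ring.
have key x : x \in s -> dot e x <= dot e y /\ (dot e x = dot e y -> x = y).
  move=> xs; have := cy x xs; rewrite le_eqVlt => /predU1P [cxy|cxy].
    have [le_xy eq_xy] := c'y x xs cxy.
    move: (eE x); rewrite cxy subrr mulr0 subr0 => exy.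
    rewrite -subr_le0 exy subr_le0; split=> // /eqP.
    by rewrite -subr_eq0 exy subr_eq0 => /eqP.
  have : dot e x < dot e y.
    by rewrite -subr_lt0 eE subr_lt0 HM // subr_gt0.
  by move=> xy; split=> [|e_xy]; [exact: ltW | rewrite e_xy ltxx in xy].
exists e, (dot e y); split.
  by apply: conv_le => x /key [].
apply/seteqP; split=> [_ ->|x [Px]]; first by split.
by apply: (conv_strict_max _ _ Px) => z /key [].
Qed.

Lemma vertices_sub P : vertices P `<=` P.
Proof.
by move=> v [c [b [_ vE]]]; have : [set v] v by []; rewrite vE => -[].
Qed.

(** A vertex of F is exposed by some c' within F and F by some c within P, so
    it is a lexicographic maximum of (c, c') on P. *)
Lemma vertices_of_face P F : polytope P -> face P F ->
  vertices F = vertices P `&` F.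
Proof.
move=> [s ->] [c [b [cb FE]]].
have Fsub x : F x -> conv [set y | y \in s] x /\ dot c x = b by rewrite FE.
apply/seteqP; split=> [v [c' [b' [c'b vE]]]|v [[c' [b' [c'b vE]]] Fv]].
  have [Fv c'v] : F v /\ dot c' v = b'.
    have : [set v] v by []. by rewrite vE.
  have [Pv cv] := Fsub _ Fv; split => //.
  apply: (@lexicographic_vertex s c c') => // x xs.
    by rewrite cv; apply: cb; exact: mem_conv.
  rewrite cv => cx.
  have Fx : F x by rewrite FE; split=> //; exact: mem_conv.
  split; rewrite c'v; first exact: c'b.
  by move=> c'x; have : [set v] x by rewrite vE.
exists c', b'; split; first by move=> x /Fsub [/c'b].
apply/seteqP; split=> [x xv|x [/Fsub [Px _] c'x]]; last by rewrite vE.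
by rewrite xv; split => //; have : [set v] v by []; rewrite {1}vE => -[].
Qed.

(** Among the generators maximizing c, the one farthest from the origin is a
    vertex: by Cauchy-Schwarz it is the strict maximum of its own inner product
    with the others. *)
Lemma exists_vertex_max P c x : polytope P -> P x ->
  exists2 y, vertices P y & dot c x <= dot c y.
Proof.
move=> [s ->] Px.
have s0 : s != [::].
  case: Px => m [p [l [ps l0 l1 _]]]; case: m p l ps l0 l1 => [|m] p l ps l0.
    by rewrite big_ord0 => /eqP; rewrite eq_sym oner_eq0.
  by move=> _; have := ps ord0; case: (s).
have [z zs zmax] := max_in_seq (dot c) s0.
pose top := [seq y <- s | dot c y == dot c z].
have top0 : top != [::].
  by rewrite -has_filter; apply/hasP; exists z.
have [y] := max_in_seq (fun y => dot y y) top0.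
rewrite mem_filter => /andP [/eqP cyz ys] ymax.
exists y; last by rewrite cyz; exact: (conv_le zmax).
apply: (@lexicographic_vertex s c y); first exact: mem_conv.
  by move=> w /zmax; rewrite cyz.
move=> w ws; rewrite cyz => cwz.
have wy : dot w w <= dot y y by apply: ymax; rewrite mem_filter cwz eqxx.
have yw : dot (y - w) (y - w) = dot y y + dot w w - 2 * dot y w.
  by rewrite dotDl !dotDr !dotNl !dotNr (dotC w y); ring.
have yw0 := dot_ge0 (y - w).
split=> [|eq_yw]; first by lra.
have : dot (y - w) (y - w) == 0 by rewrite eq_le yw0 andbT; lra.
by rewrite dot_eq0 subr_eq0 => /eqP.
Qed.

Lemma le_of_vertices P c (b : R) : polytope P ->
    (forall y, vertices P y -> dot c y <= b) ->
  forall x, P x -> dot c x <= b.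
Proof.
by move=> PP cb x /(exists_vertex_max c PP) [y /cb yb] /le_trans; apply.
Qed.

End Polytopes.

(** * Fibers and the toric ideal *)

Section Fibers.
Variables (d n : nat) (a : 'I_n -> 'rV[int]_d).
Implicit Types (u v w q r : 'X_{1..n}).

Definition fiber u : nat * 'rV[int]_d := (mdeg u, \sum_i a i *+ u i).

Lemma fiberD u v :
  fiber (u + v)%MM = (((fiber u).1 + (fiber v).1)%N, (fiber u).2 + (fiber v).2).
Proof.
rewrite /fiber mdegD -big_split /=; congr (_, _).
by apply: eq_bigr => i _; rewrite mnmDE mulrnDr.
Qed.

Lemma fiberDl u v w : fiber u = fiber v -> fiber (u + w)%MM = fiber (v + w)%MM.
Proof. by move=> uv; rewrite !fiberD uv. Qed.

Lemma fiberDI u v w : fiber (u + w)%MM = fiber (v + w)%MM -> fiber u = fiber v.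
Proof.
by rewrite !fiberD => -[/addIn e1 /addIr e2]; congr (_, _).
Qed.

Lemma fiberU i : fiber U_(i)%MM = (1%N, a i).
Proof.
rewrite /fiber mdeg1 (bigD1 i) //= mnm1E eqxx mulr1n big1 ?addr0 // => j ji.
by rewrite mnm1E eq_sym (negbTE ji).
Qed.

(** For nonnegative exponents the toric map takes its values in polynomials,
    and [toric_mnm u] is the exponent vector of the image of the monomial u. *)
Definition toric_exp i : 'X_{1..d + 1} :=
  [multinom if split k is inl j then absz (a i 0%R j) else 1%N | k < d + 1].

Definition toric_mnm u : 'X_{1..d + 1} := (\sum_i toric_exp i *+ u i)%MM.

Hypothesis a_ge0 : forall i k, 0 <= a i 0 k.

Lemma toric_mnm_l u j :
  (toric_mnm u (lshift 1 j))%:Z = (\sum_i a i *+ u i) 0 j.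
Proof.
rewrite mnm_sumE summxE (big_morph Posz PoszD (erefl 0)).
apply: eq_bigr => i _; rewrite mulmnE mnmE (unsplitK (inl j)) PoszM.
by rewrite gez0_abs // mulmxnE -mulr_natr natz.
Qed.

Lemma toric_mnm_r u : toric_mnm u (rshift d ord0) = mdeg u.
Proof.
rewrite mnm_sumE mdegE; apply: eq_bigr => i _.
by rewrite mulmnE mnmE (unsplitK (inr ord0)) mul1n.
Qed.

Lemma toric_mnm_eq u v :
  (toric_mnm u == toric_mnm v) = (fiber u == fiber v).
Proof.
apply/eqP/eqP => [uv|[uv1 uv2]].
  rewrite /fiber -!toric_mnm_r uv; congr (_, _); apply/rowP => j.
  by rewrite -!toric_mnm_l uv.
apply/mnmP => k; rewrite -(splitK k); case: (split k) => j /=.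
  by apply/eqP; rewrite -eqz_nat !toric_mnm_l uv2.
by rewrite (ord1 j) !toric_mnm_r.
Qed.

Variable K : fieldType.
Implicit Types (f g : {mpoly K[n]}) (G : set {mpoly K[n]}).

Lemma toric_map_tofrac f : toric_map a f =
  tofrac (\sum_(u <- msupp f) f@_u *: 'X_[toric_mnm u]).
Proof.
rewrite /toric_map /mmap rmorph_sum; apply: eq_bigr => u _.
rewrite -mul_mpolyC rmorphM /=; congr (_ * _).
rewrite /toric_mnm (big_morph _ (@mpolyXD _ K) (@mpolyX0 _ K)) rmorph_prod.
apply: eq_bigr => i _; rewrite -mpolyXn rmorphXn; congr (_ ^+ _).
rewrite mpolyXE_id rmorph_prod big_split_ord big_ord1 /=; congr (_ * _).
  apply: eq_bigr => k _; rewrite rmorphXn /laurent_t mnmE (unsplitK (inl k)).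
  by rewrite exprnP gez0_abs.
by rewrite mnmE (unsplitK (inr ord0)) expr1.
Qed.

(** Images of monomials from different fibers are different monomials, so the
    coefficients of f have to cancel within each fiber. *)
Lemma toric_idealP f : toric_ideal K a f <->
  forall w, \sum_(u <- msupp f | fiber u == fiber w) f@_u = 0.
Proof.
have coefE z : (\sum_(u <- msupp f) f@_u *: 'X_[toric_mnm u])@_z =
    \sum_(u <- msupp f | toric_mnm u == z) f@_u.
  rewrite raddf_sum [RHS]big_mkcond; apply: eq_bigr => u _ /=.
  by rewrite mcoeffZ mcoeffX; case: eqP; rewrite ?mulr1 ?mulr0.
rewrite /toric_ideal /= toric_map_tofrac; split=> [/eqP f0 w|f0].
  rewrite tofrac_eq0 in f0; move/eqP: f0 => f0.
  have := coefE (toric_mnm w); rewrite f0 mcoeff0 => /esym w0; rewrite -[RHS]w0.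
  by apply: eq_bigl => u; rewrite toric_mnm_eq.
apply/eqP; rewrite tofrac_eq0; apply/eqP/mpolyP => z; rewrite coefE mcoeff0.
have [/hasP [w _ /eqP <-]|/hasPn none] :=
  boolP (has (fun u => toric_mnm u == z) (msupp f)).
  by rewrite -[RHS](f0 w); apply: eq_bigl => u; rewrite toric_mnm_eq.
by rewrite big_seq_cond big1 // => u /andP [/none /negbTE ->].
Qed.

Lemma mem_msupp_binomial u v m : u != v ->
  (m \in msupp ('X_[u] - 'X_[v] : {mpoly K[n]})) = (m == u) || (m == v).
Proof.
move=> uv; rewrite mcoeff_msupp mcoeffB !mcoeffX ![_ == m]eq_sym.
have [->|mu] := eqVneq m u; first by rewrite (negbTE uv) subr0 oner_eq0.
by case: (m == v); rewrite sub0r oppr_eq0 ?oner_eq0 ?eqxx.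
Qed.

(** [toric_map] with its coefficient map written as a composite of ring
    morphisms, which makes the multiplicativity of [mmap] available. *)
Definition toric_rmorphism :
    {rmorphism {mpoly K[n]} -> {fraction {mpoly K[d + 1]}}} :=
  mmap (@tofrac {mpoly K[d + 1]} \o @mpolyC (d + 1) K)
    (fun i => \prod_(k < d) laurent_t K k ^ a i 0 k * laurent_s K d).

Lemma toric_mapE : toric_map a =1 toric_rmorphism.
Proof. by []. Qed.

Lemma toric_ideal_binomial u v :
  toric_ideal K a ('X_[u] - 'X_[v]) <-> fiber u = fiber v.
Proof.
have mapX w : toric_map a ('X_[w] : {mpoly K[n]}) = tofrac 'X_[toric_mnm w].
  by rewrite toric_map_tofrac msuppX big_seq1 mcoeffX eqxx scale1r.
rewrite /toric_ideal /= toric_mapE rmorphB -!toric_mapE !mapX -rmorphB.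
split=> [/eqP|e].
  rewrite tofrac_eq0 subr_eq0 => /eqP /(congr1 (mcoeff (toric_mnm u))).
  rewrite !mcoeffX eqxx; have [|_ /eqP] := eqVneq (toric_mnm v) (toric_mnm u).
    by move/eqP; rewrite toric_mnm_eq => /eqP.
  by rewrite oner_eq0.
have /eqP -> : toric_mnm u == toric_mnm v by rewrite toric_mnm_eq e.
by rewrite subrr rmorph0.
Qed.

Lemma ideal_generated_toric G : G `<=` toric_ideal K a ->
  ideal_generated G `<=` toric_ideal K a.
Proof.
move=> GI _ [s [sG ->]]; rewrite /toric_ideal /= toric_mapE rmorph_sum.
rewrite big_seq big1 // => c /sG /GI cI.
by rewrite rmorphM -!toric_mapE cI mulr0.
Qed.

End Fibers.

Section GeneratedIdeal.
Variables (K : fieldType) (n : nat) (G : set {mpoly K[n]}).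

Lemma ideal_generated_mem h g : G g -> ideal_generated G (h * g).
Proof.
move=> Gg; exists [:: (h, g)]; split; last by rewrite big_seq1.
by move=> c; rewrite inE => /eqP ->.
Qed.

Lemma ideal_generated0 : ideal_generated G 0.
Proof. by exists [::]; rewrite big_nil. Qed.

Lemma ideal_generatedD f g :
  ideal_generated G f -> ideal_generated G g -> ideal_generated G (f + g).
Proof.
move=> [s [sG ->]] [t [tG ->]]; exists (s ++ t); split; last by rewrite big_cat.
by move=> c; rewrite mem_cat => /orP [/sG|/tG].
Qed.

Lemma ideal_generatedM h f : ideal_generated G f -> ideal_generated G (h * f).
Proof.
move=> [s [sG ->]]; exists [seq (h * c.1, c.2) | c <- s]; split.
  by move=> _ /mapP [c cs ->]; exact: (sG c).
by rewrite big_map mulr_sumr; apply: eq_bigr => c _; rewrite mulrA.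
Qed.

Lemma ideal_generated_id : G `<=` ideal_generated G.
Proof. by move=> g Gg; rewrite -[g]mul1r; exact: ideal_generated_mem. Qed.

End GeneratedIdeal.

(** Replacing each monomial of f by a fixed representative of its fiber changes
    f by a combination of binomials; the result is 0, because the coefficients
    of f cancel within each fiber. *)
Lemma toric_ideal_sub_generated (K : fieldType) d n (a : 'I_n -> 'rV[int]_d)
    (G : set {mpoly K[n]}) :
    (forall i k, 0 <= a i 0 k) ->
    (forall u v, fiber a u = fiber a v ->
       ideal_generated G ('X_[u] - 'X_[v])) ->
  toric_ideal K a `<=` ideal_generated G.
Proof.
move=> a0 binG f /(toric_idealP a0) f0.
(* rep u is the first monomial of f in the fiber of u; the default u of nth is
   reached only when there is none. *)
pose rep u :=
  nth u (msupp f) (find (fun v => fiber a v == fiber a u) (msupp f)).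
have rep_eq u v : u \in msupp f -> fiber a u = fiber a v -> rep u = rep v.
  move=> uf uv; rewrite /rep uv; apply: set_nth_default; rewrite -has_find.
  by apply/hasP; exists u => //=; rewrite uv.
have fiber_rep u : u \in msupp f -> fiber a (rep u) = fiber a u.
  move=> uf; apply/eqP.
  apply: (@nth_find _ u (fun v => fiber a v == fiber a u) (msupp f)).
  by apply/hasP; exists u.
have rep0 : \sum_(u <- msupp f) f@_u *: 'X_[rep u] = 0.
  apply/mpolyP => z; rewrite raddf_sum mcoeff0 big_seq /=.
  rewrite (eq_bigr (fun u => if fiber a u == fiber a z then
      f@_u * (rep z == z)%:R else 0)) => [|u uf].
    by rewrite -big_seq -big_mkcond -mulr_suml f0 mul0r.
  rewrite mcoeffZ mcoeffX; have [uz|uz] := eqVneq (fiber a u) (fiber a z).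
    by rewrite (rep_eq u z).
  case: eqVneq => [ruz|_]; last by rewrite mulr0.
  by rewrite -(fiber_rep _ uf) ruz eqxx in uz.
have -> : f = \sum_(u <- msupp f) f@_u *: ('X_[u] - 'X_[rep u]).
  rewrite [LHS]mpolyE; under [RHS]eq_bigr do rewrite scalerBr.
  by rewrite sumrB rep0 subr0.
rewrite big_seq; elim/big_ind: _ => [||u uf].
- exact: ideal_generated0.
- exact: ideal_generatedD.
- by rewrite -mul_mpolyC; apply/ideal_generatedM/binG; rewrite fiber_rep.
Qed.

(** * Quadratic binomials and indispensable monomials *)

Section Quadrics.
Variables (d n : nat) (a : 'I_n -> 'rV[int]_d).
Implicit Types (u v w q r m : 'X_{1..n}).

(** The divisibility condition at a single monomial u, in terms of exponents
    alone; q' has degree 2 because q has. *)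
Definition quadric_reducible u := exists q q' : 'X_{1..n},
  [/\ q != q', fiber a q = fiber a q', mdeg q = 2%N & (q <= u)%MM].

Lemma binomial_monomials_quadraticP (K : fieldType) :
    (forall i k, 0 <= a i 0 k) ->
  binomial_monomials_quadratic (toric_ideal K a) <->
  forall u v, u != v -> fiber a u = fiber a v -> quadric_reducible u.
Proof.
move=> a0; split=> [H u v uv fuv|H f m fI [u [v [uv fE]]]].
  have [|||g [q [gI [[q1 [q2 [q12 gE]]] ghom] qg qu]]] :=
    H ('X_[u] - 'X_[v]) u.
  - by apply/toric_ideal_binomial.
  - by exists u, v.
  - by rewrite mem_msupp_binomial // eqxx.
  have dq : mdeg q = 2%N := dhomog_mf ghom qg.
  move: gI qg; rewrite gE => /(toric_ideal_binomial a0) f12.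
  rewrite mem_msupp_binomial // => /orP [] /eqP eq_q; subst q.
    by exists q1, q2.
  by exists q2, q1; rewrite eq_sym.
move: fI; rewrite fE => /(toric_ideal_binomial a0) fuv.
rewrite mem_msupp_binomial // => mE.
have [q [q' [qq' fqq' dq qm]]] : quadric_reducible m.
  case/orP: mE => /eqP ->; first exact: (H u v).
  by apply: (H v u); rewrite // eq_sym.
exists ('X_[q] - 'X_[q']), q; split=> //.
- by apply/toric_ideal_binomial.
- split; first by exists q, q'.
  by rewrite rpredB // dhomogX -?dq //; case: fqq' => ->.
- by rewrite mem_msupp_binomial // eqxx.
Qed.

(** Any binomial x^m - x^v of the ideal is rewritten through the quadric that
    divides x^m; the quadratic binomial does not involve x^m because m has
    degree at least 3. *)
Lemma not_indispensable_reducible (K : fieldType) m :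
    (forall i k, 0 <= a i 0 k) -> (3 <= mdeg m)%N ->
    (forall v, m != v -> fiber a m = fiber a v -> quadric_reducible m) ->
  ~ indispensable (toric_ideal K a) m.
Proof.
move=> a0 dm red ind.
pose G : set {mpoly K[n]} :=
  [set g | [/\ toric_ideal K a g, binomial g & m \notin msupp g]].
suff genG : binomial_generators (toric_ideal K a) G.
  by have [g [_ _ /negP]] := ind G genG.
have avoiding u v : u != m -> v != m -> fiber a u = fiber a v ->
    ideal_generated G ('X_[u] - 'X_[v]).
  move=> um vm uv; have [->|nuv] := eqVneq u v.
    by rewrite subrr; exact: ideal_generated0.
  apply: ideal_generated_id; split; first exact/toric_ideal_binomial.
    by exists u, v.
  by rewrite mem_msupp_binomial // negb_or !(eq_sym m) um.
have through v : v != m -> fiber a m = fiber a v ->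
    ideal_generated G ('X_[m] - 'X_[v]).
  move=> vm mv; have [|q [q' [qq' fq dq qm]]] := red v _ mv.
    by rewrite eq_sym.
  have mE := submK qm; set r := (m - q)%MM in mE.
  have -> : 'X_[m] - 'X_[v] = 'X_[r] * ('X_[q] - 'X_[q']) +
      ('X_[(r + q')%MM] - 'X_[v]) :> {mpoly K[n]}.
    by rewrite -[in LHS]mE !mpolyXD mulrBr addrA subrK.
  have dq' : mdeg q' = 2%N by case: fq; rewrite dq.
  apply: ideal_generatedD.
    apply/ideal_generatedM/avoiding => //.
      by apply: contraTneq dm => <-; rewrite dq.
    by apply: contraTneq dm => <-; rewrite dq'.
  apply: avoiding => //.
    by rewrite -[X in _ != X]mE eqm_add2l eq_sym.
  by rewrite -mv -[in RHS]mE !(addmC r); exact: fiberDl.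
split=> [g []//|].
apply/seteqP; split.
  by apply: ideal_generated_toric => g [].
apply: toric_ideal_sub_generated => // u v uv.
have [um|um] := eqVneq u m; have [vm|vm] := eqVneq v m.
- by rewrite um vm subrr; exact: ideal_generated0.
- by rewrite um in uv *; exact: through.
- rewrite -opprB -mulN1r; apply: ideal_generatedM.
  by rewrite vm in uv *; exact: through.
- exact: avoiding.
Qed.

End Quadrics.

Lemma mdeg2P n (q : 'X_{1..n}) :
  mdeg q = 2%N -> exists i j, q = (U_(i) + U_(j))%MM.
Proof.
move=> dq; have [i qi] : exists i, q i != 0%N.
  apply/existsP; apply: contraPT dq; rewrite negb_exists => /forallP q0.
  rewrite mdegE big1 // => i _; apply/eqP.
  by have := q0 i; rewrite negbK.
have qE := submK (introT idP (eq_ind_r is_true qi (lep1mP i q))).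
have /eqP/mdeg1P [j /eqP e] : mdeg (q - U_(i))%MM = 1%N.
  by apply/eqP; rewrite -(eqn_add2r 1) -{1}(mdeg1 i) -mdegD qE dq.
by exists j, i; rewrite -e qE.
Qed.

Lemma mnm2_perm n (i j k l : 'I_n) :
  (U_(i) + U_(j) = U_(k) + U_(l))%MM <-> perm_eq [:: i; j] [:: k; l].
Proof.
split=> [/mnmP e|/(perm_big _) e].
  apply/allP => x _ /=; have := e x.
  by rewrite !mnmDE !mnm1E !addn0 => ->.
move: (e _ (@mnm_add n) 0%MM predT (fun x => U_(x)%MM)).
by rewrite !big_cons !big_nil /= !addm0.
Qed.

(** * Separating a set of points from another point *)

Section Separation.
Variables (d n : nat) (a : 'I_n -> 'rV[int]_d).
Implicit Types (u v : 'X_{1..n}).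

(** Adding a last coordinate 1 turns affine relations between the a i, that is,
    equalities of fibers, into linear ones. *)
Definition homogenize i : 'rV[int]_(d + 1) := row_mx (a i) (const_mx 1).

Lemma sum_homogenize u :
  \sum_i (u i)%:Z *: homogenize i = row_mx (fiber a u).2 (const_mx (mdeg u)%:Z).
Proof.
rewrite /homogenize; under eq_bigr do rewrite scale_row_mx.
apply/rowP => k; rewrite summxE -(splitK k); case: (split k) => j /=.
  under eq_bigr do rewrite row_mxEl.
  rewrite row_mxEl summxE; apply: eq_bigr => i _.
  by rewrite mxE mulmxnE -mulr_natl natz.
under eq_bigr do rewrite row_mxEr.
rewrite row_mxEr mxE mdegE (big_morph Posz PoszD (erefl 0)).
by apply: eq_bigr => i _; rewrite !mxE mulr1.
Qed.

Lemma dot_homogenize i (x : 'rV[int]_(d + 1)) :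
  dot (homogenize i) x = dot (lsubmx x) (a i) + rsubmx x 0 0.
Proof.
rewrite dotC /dot big_split_ord big_ord1; congr (_ + _).
  by apply: eq_bigr => k _; rewrite row_mxEl mxE.
by rewrite row_mxEr !mxE mulr1.
Qed.

(** Farkas applied to the target - (a j, 1) and to the generators (a i, 1) for
    all i and - (a i, 1) for i in S. A functional that is nonpositive on the
    generators is an affine functional that is nonpositive on all a i and zero
    on S; being positive at the target, it is negative at a j. A conic
    relation, with its negative terms moved to the other side, is an equality
    of fibers. *)
Lemma separate_or_fiber (S : pred 'I_n) j : ~~ S j ->
  (exists cb : 'rV[int]_d * int,
    [/\ forall i, dot cb.1 (a i) <= cb.2, forall i, S i -> dot cb.1 (a i) = cb.2
      & dot cb.1 (a j) < cb.2]) \/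
  (exists u v, [/\ fiber a u = fiber a v, forall i, u i != 0%N -> S i
     & v j != 0%N]).
Proof.
move=> Sj.
(* Outside S the second half of the generators consists of zero vectors. *)
pose gens (k : 'I_(n + n)) := match split k with
  | inl i => homogenize i
  | inr i => - ((S i)%:R *: homogenize i) end.
have [[x gx jx]|[t [l [t0 l0 tl]]]] := farkas gens (- homogenize j).
  have le0 i : dot (lsubmx x) (a i) + rsubmx x 0 0 <= 0.
    by have := gx (lshift n i); rewrite /gens (unsplitK (inl i)) dot_homogenize.
  have ge0 i : S i -> 0 <= dot (lsubmx x) (a i) + rsubmx x 0 0.
    move=> Si; have := gx (rshift n i); rewrite /gens (unsplitK (inr i)) Si.
    by rewrite scale1r dotNl dot_homogenize oppr_le0.
  rewrite dotNl dot_homogenize oppr_gt0 in jx.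
  left; exists (lsubmx x, - rsubmx x 0 0); split=> [i|i Si|] /=.
  - by rewrite -subr_le0 opprK.
  - by apply/eqP; rewrite -subr_eq0 opprK eq_le le0 ge0.
  - by rewrite -subr_lt0 opprK.
right.
pose u : 'X_{1..n} := [multinom (S i * absz (l (rshift n i)))%N | i < n].
pose v : 'X_{1..n} :=
  [multinom ((i == j) * absz t + absz (l (lshift n i)))%N | i < n].
exists u, v; split.
- have uE : \sum_i (u i)%:Z *: homogenize i =
      - \sum_i l (rshift n i) *: gens (rshift n i).
    rewrite -sumrN; apply: eq_bigr => i _.
    rewrite mnmE /gens (unsplitK (inr i)) scalerN opprK scalerA mulrC.
    by rewrite PoszM gez0_abs // natz.
  have vE : \sum_i (v i)%:Z *: homogenize i =
      t *: homogenize j + \sum_i l (lshift n i) *: gens (lshift n i).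
    rewrite (bigD1 j) //= [X in _ = _ + X](bigD1 j) //= addrA; congr (_ + _).
      by rewrite mnmE eqxx mul1n PoszD !gez0_abs // ?ltW // scalerDl /gens
        (unsplitK (inl j)).
    apply: eq_bigr => i /negbTE ij.
    by rewrite mnmE ij mul0n add0n gez0_abs // /gens (unsplitK (inl i)).
  have : \sum_i (u i)%:Z *: homogenize i = \sum_i (v i)%:Z *: homogenize i.
    rewrite uE vE -[t *: _]opprK -scalerN tl big_split_ord opprD addrAC.
    by rewrite [- _ + _]addrC subrr add0r.
  rewrite !sum_homogenize => /eq_row_mx [uv2 /rowP /(_ 0)].
  by rewrite !mxE => -[uv1]; apply: injective_projections.
- by move=> i; rewrite mnmE; case: (S i).
- by rewrite mnmE eqxx mul1n -lt0n addn_gt0 absz_gt0 gt_eqF.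
Qed.

End Separation.

(** * Cliques and faces of a polytope with condition (E) *)

Section CliquesAndFaces.
Variables (R : realType) (d n : nat).
Variables (P : set 'rV[R]_d) (a : 'I_n -> 'rV[int]_d).
Hypotheses (P01 : polytope01 P) (a_inj : injective a)
  (a_vert : vertices P = [set map_mx intr (a i) | i in [set: 'I_n]])
  (PE : conditionE P).
Implicit Types (u v q : 'X_{1..n}) (C : set 'rV[R]_d).

Let A i : 'rV[R]_d := map_mx intr (a i).

Let intrR_inj : injective (intr : int -> R).
Proof. by move=> x y /eqP; rewrite eqr_int => /eqP. Qed.

Let map_intr_inj : injective (map_mx (intr : int -> R) : 'rV_d -> 'rV_d).
Proof.
by move=> x y /rowP e; apply/rowP => k; have := e k; rewrite !mxE => /intrR_inj.
Qed.

Lemma lattice_point_inj : injective A.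
Proof. by move=> i j /map_intr_inj /a_inj. Qed.

Lemma lattice_point_vertex i : vertices P (A i).
Proof. by rewrite a_vert; exists i. Qed.

Lemma coord01 i k : a i 0 k = 0 \/ a i 0 k = 1.
Proof.
have [_ /(_ _ (lattice_point_vertex i) k)] := P01; rewrite mxE.
by case=> [|/(@intrR_inj _ 1)]; [move/(@intrR_inj _ 0)|]; [left|right].
Qed.

Lemma coord_ge0 i k : 0 <= a i 0 k.
Proof. by case: (coord01 i k) => ->. Qed.

Lemma add_lattice_points i j k l :
  A i + A j = A k + A l <-> a i + a j = a k + a l.
Proof.
by rewrite /A -!map_mxD; split=> [/map_intr_inj|->].
Qed.

Lemma fiber2 i j : fiber a (U_(i) + U_(j)) = (2%N, a i + a j).
Proof. by rewrite fiberD !fiberU. Qed.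

Lemma fiber2P i j q : fiber a q = fiber a (U_(i) + U_(j)) ->
  exists k l, q = (U_(k) + U_(l))%MM /\ a k + a l = a i + a j.
Proof.
move=> fq; have [|k [l qE]] := @mdeg2P _ q.
  by move: fq; rewrite fiber2 => -[].
by exists k, l; split=> //; move: fq; rewrite qE !fiber2 => -[].
Qed.

(** Condition (E), translated: writings of A i + A j as a sum of two vertices,
    up to order, are the quadratic monomials in the fiber of x_i x_j. *)
Lemma edge_unique_fiber i j : i != j ->
  edge P (conv [set A i; A j]) <->
  (forall q, fiber a q = fiber a (U_(i) + U_(j)) -> q = (U_(i) + U_(j))%MM).
Proof.
move=> ij; have Vi := lattice_point_vertex.
have Aij : A i != A j by apply: contra_neq ij; exact: lattice_point_inj.
rewrite (PE (Vi i) (Vi j) Aij); split=> [[v [w [_ _ vw uniq]]] q|uniq].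
  move=> /fiber2P [k [l [-> /esym akl]]]; apply/mnm2_perm.
  apply: (perm_map_inj lattice_point_inj) => /=.
  rewrite (permPl (uniq _ _ (Vi k) (Vi l) _)); last exact/add_lattice_points.
  by rewrite perm_sym; exact: uniq.
exists (A i), (A j); split=> // v w; rewrite a_vert => -[k _ <-] [l _ <-].
move=> /add_lattice_points akl.
have /mnm2_perm kl : (U_(k) + U_(l) = U_(i) + U_(j))%MM.
  by apply: uniq; rewrite !fiber2 akl.
exact: (perm_map A kl).
Qed.

(** Coordinatewise, a sum of two numbers in {0, 1} equals 0 or 2 only if both
    summands are equal. *)
Lemma fiber_double i q :
  fiber a q = fiber a (U_(i) + U_(i)) -> q = (U_(i) + U_(i))%MM.
Proof.
move=> /fiber2P [k [l [-> /rowP akl]]].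
have [ki li] : a k = a i /\ a l = a i.
  split; apply/rowP => x; have := akl x; rewrite !mxE;
    by case: (coord01 k x) => ->; case: (coord01 l x) => ->;
       case: (coord01 i x) => ->.
by rewrite (a_inj ki) (a_inj li).
Qed.

Lemma sum_dot_fiber (c : 'rV[R]_d) u :
  \sum_i dot c (A i) *+ u i = dot c (map_mx intr (fiber a u).2).
Proof.
rewrite map_mx_sum dot_sumr; apply: eq_bigr => i _.
by rewrite raddfMn -scaler_nat dotZr mulr_natl.
Qed.

(** The gaps b - c.A i are nonnegative, and their u-weighted and v-weighted
    sums agree because u and v have the same fiber; the former is 0. *)
Lemma face_fiber_support F u v : face P F -> fiber a u = fiber a v ->
    (forall i, u i != 0%N -> F (A i)) ->
  forall j, v j != 0%N -> F (A j).
Proof.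
move=> [c [b [cb FE]]] fuv uF j vj.
have cbA i : dot c (A i) <= b.
  by apply: cb; exact: (vertices_sub (lattice_point_vertex i)).
have gapE (w : 'X_{1..n}) : \sum_i (b - dot c (A i)) *+ w i =
    b *+ mdeg w - dot c (map_mx intr (fiber a w).2).
  rewrite -sum_dot_fiber mdegE -sumrMnr -sumrB.
  by apply: eq_bigr => i _; rewrite mulrnBl.
have : \sum_i (b - dot c (A i)) *+ v i == 0.
  rewrite gapE -fuv; have /(congr1 fst) /= <- := fuv; rewrite -gapE.
  rewrite big1 // => i _; have [->//|/uF] := eqVneq (u i) 0%N.
  by rewrite FE => -[_ <-]; rewrite subrr mul0rn.
rewrite psumr_eq0 => [/allP v0|i _]; last by rewrite mulrn_wge0 // subr_ge0.
have := v0 j (mem_index_enum _); rewrite /= mulrn_eq0 (negbTE vj) subr_eq0.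
move=> /eqP bj; rewrite FE; split=> //.
exact: (vertices_sub (lattice_point_vertex j)).
Qed.

(** After cancelling the common factor g, the support of u' = u / g would be
    the vertex set of a face, which has to contain the disjoint support of v' =
    v / g. *)
Lemma clique_face_reducible u v : clique_face P ->
  u != v -> fiber a u = fiber a v -> quadric_reducible a u.
Proof.
move=> CF uv fuv; apply: contrapT => irr.
pose g : 'X_{1..n} := [multinom minn (u i) (v i) | i < n].
have uE : (u - g + g)%MM = u.
  by apply: submK; apply/mnm_lepP => i; rewrite mnmE geq_minl.
have vE : (v - g + g)%MM = v.
  by apply: submK; apply/mnm_lepP => i; rewrite mnmE geq_minr.
set u' := (u - g)%MM in uE; set v' := (v - g)%MM in vE.
have fuv' : fiber a u' = fiber a v'
  by apply: (@fiberDI _ _ _ _ _ g); rewrite uE vE.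
have disj i : u' i != 0%N -> v' i = 0%N.
  by rewrite !mnmBE mnmE; case: (leqP (u i) (v i)) => _; rewrite subnn.
pose C : set 'rV[R]_d := [set A i | i in [set i | u' i != 0%N]].
have cliqueC : clique P C.
  split=> [_ [i _ <-]|_ _ [i ui <-] [j uj <-] Aij].
    exact: lattice_point_vertex.
  have ij : i != j by apply: contraNneq Aij => ->.
  split=> //; [exact: lattice_point_vertex..|].
  apply/edge_unique_fiber => // q fq; apply: contrapT => /eqP qij; apply: irr.
  exists (U_(i) + U_(j))%MM, q; split=> //; first by rewrite eq_sym.
    by rewrite mdegD !mdeg1.
  apply: (@lepm_trans _ _ _ u'); last by rewrite -uE lem_addr.
  apply/mnm_lepP => k; rewrite mnmDE !mnm1E.
  have [ik|_] := eqVneq i k; last by case: eqVneq => // <-; rewrite lt0n.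
  by rewrite -ik eq_sym (negbTE ij) lt0n.
have [F faceF CE] := CF C cliqueC.
have VF := vertices_of_face (proj1 P01) faceF.
have v'0 j : v' j = 0%N.
  apply/eqP; apply: contraT => vj.
  have : C (A j).
    rewrite CE VF; split; first exact: lattice_point_vertex.
    apply: (face_fiber_support faceF fuv') vj => i ui.
    have : vertices F (A i) by rewrite -CE; exists i.
    by rewrite VF => -[].
  by move=> [i ui /lattice_point_inj ij]; rewrite -ij (disj i ui) in vj.
have v'E : v' = 0%MM by apply/mnmP => j; rewrite v'0 mnm0E.
have u'E : u' = 0%MM.
  apply/eqP; rewrite -mdeg_eq0; have /(congr1 fst) /= -> := fuv'.
  by rewrite v'E mdeg0.
by move/eqP: uv; apply; rewrite -uE -vE u'E v'E.
Qed.

(** The functional cutting out the face is the sum, over the vertices outside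
    the clique, of functionals that separate one such vertex from the clique. *)
Lemma reducible_clique_face :
    (forall u v, u != v -> fiber a u = fiber a v -> quadric_reducible a u) ->
  clique_face P.
Proof.
move=> red C [CV CE].
pose S i := `[< C (A i) >].
(* A quadric dividing a monomial supported on C is alone in its fiber, so such
   a monomial shares its fiber with no other. *)
have unrelated u v : fiber a u = fiber a v -> (forall i, u i != 0%N -> S i) ->
    u = v.
  move=> fuv uS; apply/eqP; apply: contraT => /red /(_ fuv).
  move=> [q [q' [qq' fqq' /mdeg2P [i [j qE]] qu]]]; subst q.
  have Si : S i.
    apply: uS; have /mnm_lepP /(_ i) := qu; rewrite mnmDE mnm1E eqxx -lt0n.
    exact: leq_trans.
  have Sj : S j.
    apply: uS; have /mnm_lepP /(_ j) := qu; rewrite mnmDE (mnm1E j) eqxx -lt0n.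
    by apply: leq_trans; rewrite addn1.
  move/eqP: qq' => []; apply/esym; have [ij|ij] := eqVneq i j.
    by move: fqq'; rewrite ij => /esym /fiber_double.
  have [|_ _ _ Eij] := CE (A i) (A j) (asboolW Si) (asboolW Sj).
    by apply: contra_neq ij; exact: lattice_point_inj.
  by move/(edge_unique_fiber ij): Eij; apply; rewrite fqq'.
have sep j : exists cb : 'rV[int]_d * int,
    [/\ forall i, dot cb.1 (a i) <= cb.2, forall i, S i -> dot cb.1 (a i) = cb.2
      & ~~ S j -> dot cb.1 (a j) < cb.2].
  have [Sj|Sj] := boolP (S j).
    by exists (0, 0); split=> // i; rewrite dotC dot0r.
  have [[cb [le_cb eq_cb lt_cb]]|[u [v [fuv uS vj]]]] := separate_or_fiber a Sj.
    by exists cb.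
  by move: vj (Sj); rewrite -(unrelated u v) // => /uS ->.
have [cb cbP] := choice sep.
pose c := \sum_j (cb j).1; pose b := \sum_j (cb j).2.
have dotcE i : dot c (a i) = \sum_j dot (cb j).1 (a i).
  by rewrite dotC dot_sumr; apply: eq_bigr => j _; rewrite dotC.
have dotA i : dot (map_mx intr c) (A i) = (dot c (a i))%:~R :> R.
  by rewrite rmorph_sum; apply: eq_bigr => k _; rewrite !mxE rmorphM.
pose F := P `&` [set x | dot (map_mx intr c) x = b%:~R].
have faceF : face P F.
  exists (map_mx intr c), b%:~R; split=> //.
  apply: le_of_vertices; first exact: (proj1 P01).
  move=> y; rewrite a_vert => -[i _ <-]; rewrite -/(A i) dotA ler_int dotcE.
  by apply: ler_sum => j _; have [] := cbP j.
exists F => //; rewrite (vertices_of_face (proj1 P01) faceF).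
apply/seteqP; split=> [x Cx|x [Vx [_ /= xF]]].
  have Vx := CV x Cx; split=> //; split; first exact: vertices_sub.
  move: Vx Cx; rewrite a_vert => -[i _ <-] Ci /=; rewrite -/(A i) dotA dotcE.
  congr (_%:~R); apply: eq_bigr => j _.
  by have [_ + _] := cbP j; apply; exact/asboolP.
move: Vx xF; rewrite a_vert => -[j _ <-]; rewrite -/(A j) dotA dotcE.
move=> /intrR_inj e; apply/asboolP; apply: contraT => Sj.
have : \sum_k dot (cb k).1 (a j) < b.
  rewrite [ltLHS](bigD1 j) //= /b [ltRHS](bigD1 j) //=; apply: ltr_leD.
    by have [_ _ ->] := cbP j.
  by apply: ler_sum => k _; have [] := cbP k.
by rewrite e ltxx.
Qed.

End CliquesAndFaces.

Theorem theorem1p3 (R : realType) (K : fieldType) (d n : nat)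
    (P : set 'rV[R]_d) (a : 'I_n -> 'rV[int]_d)
    (P01 : polytope01 P)
    (a_inj : injective a)
    (a_vert : vertices P = [set map_mx intr (a i) | i in [set: 'I_n]])
    (PE : conditionE P) :
  (clique_face P <-> binomial_monomials_quadratic (toric_ideal K a)) /\
  (clique_face P ->
     forall m : 'X_{1..n}, (3 <= mdeg m)%N ->
       ~ indispensable (toric_ideal K a) m).
Proof.
have a_ge0 := coord_ge0 P01 a_vert.
have CF_red := clique_face_reducible P01 a_inj a_vert PE.
split; last first.
  by move=> CF m dm; apply: not_indispensable_reducible => // v; exact: CF_red.
split=> [CF|/(binomial_monomials_quadraticP _ a_ge0) red].
  by apply/binomial_monomials_quadraticP => // u v; exact: CF_red.
exact: (reducible_clique_face P01 a_inj a_vert PE).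
Qed.
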